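(* Let $n\ge2$ and let $a=\sum_{\alpha\in I(\mathbb{KP}_n)}a_\alpha\chi_\alpha\in C(\mathbb{KP}_n)$ (with $a_\alpha\in\mathbb C$) be such that $\mathcal F(a)$ is a state. For any non-trivial irreducible representation $\alpha\in I(\mathbb{KP}_n)\setminus\{\rho_0^+\}$ and any natural integer $k$, $$\frac12\left|\frac{a_\alpha}{d_\alpha}\right|^k\le\left\lVert\mathcal F(a)^{\star k}-\int_{\mathbb{KP}_n}\right\rVert_{QTV}.$$
   Context: Sekine quantum group $\mathbb{KP}_n$ ($n\ge2$). Put $\eta=e^{2\imath\pi/n}$; all indices are taken modulo $n$. $C(\mathbb{KP}_n)=\bigoplus_{i,j\in\mathbb Z_n}\mathbb C e_{(i,j)}\oplus M_n(\mathbb C)$ as a $*$-algebra, where the $e_{(i,j)}$ are the units of the one-dimensional summands and $E_{i,j}$ ($1\le i,j\le n$) are matrix units of $M_n(\mathbb C)$. The coproduct is $\Delta(e_{(i,j)})=\sum_{s,t\in\mathbb Z_n}e_{(s,t)}\otimes e_{(i-s,j-t)}+\frac1n\sum_{m,r=1}^n\eta^{i(m-r)}E_{m,r}\otimes E_{m+j,r+j}$, $\Delta(E_{i,j})=\sum_{s,t\in\mathbb Z_n}\eta^{s(i-j)}e_{(-s,-t)}\otimes E_{i-t,j-t}+\sum_{s,t\in\mathbb Z_n}\eta^{s(j-i)}E_{i-t,j-t}\otimes e_{(s,t)}$. The Haar state is $\int_{\mathbb{KP}_n}\big(\sum x_{(i,j)}e_{(i,j)}+\sum X_{i,j}E_{i,j}\big)=\frac1{2n^2}\big(\sum_{i,j}x_{(i,j)}+n\sum_iX_{i,i}\big)$.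 For $x\in C(\mathbb{KP}_n)$, $\mathcal F(x)$ is the linear functional $y\mapsto\int_{\mathbb{KP}_n}yx$. The convolution of functionals is $\phi\star\psi=(\phi\otimes\psi)\circ\Delta$, and $\phi^{\star k}$ is the $k$-fold convolution power ($\phi^{\star0}$ being the counit, i.e. the coefficient of $e_{(0,0)}$; $0^0=1$). A state is a positive unital linear functional. $\lVert\phi-\psi\rVert_{QTV}=\sup\{|\phi(p)-\psi(p)|:p\in C(\mathbb{KP}_n)\text{ a projection}\}$. Irreducible representations: $I(\mathbb{KP}_n)$ is the set of (classes of) irreducible representations, $d_\alpha$ is the dimension and $\chi_\alpha$ the character of $\alpha$. It consists of the one-dimensional $\rho_l^\pm=\sum_{i,j}\eta^{il}e_{(i,j)}\pm\sum_{m=1}^nE_{m,m+l}$ ($l\in\mathbb Z_n$; $\rho_0^+$ is the unit), the two-dimensional $\mathfrak X^{u,v}$ ($u\in\mathbb Z_n$, $1\le v\le\lfloor\frac{n-1}2\rfloor$) with characters $2\sum_{s,t\in\mathbb Z_n}\eta^{su}\cos(\frac{2tv\pi}n)e_{(s,t)}$, and, if $n$ is even, also the one-dimensional $\sigma_l^\pm=\sum_{i,j}(-1)^j\eta^{il}e_{(i,j)}\pm\sum_{m=1}^n(-1)^mE_{m,m+l}$ ($l\in\mathbb Z_n$). *)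

(* Defs.v *)
From HB Require Import structures.
From mathcomp Require Import all_boot all_order all_algebra complex.
From mathcomp Require Import all_classical all_reals all_analysis.

Set Implicit Arguments.
Unset Strict Implicit.
Unset Printing Implicit Defensive.

Import Order.TTheory GRing.Theory Num.Theory.
Import ComplexField.

Local Open Scope classical_set_scope.
Local Open Scope ring_scope.
Local Open Scope complex_scope.
Local Open Scope sesquilinear_scope.

(* Everything below is meant for 1 < n, where 'Z_n is Z/nZ; rows and columns  *)
(* of M_n(C) are indexed by 'Z_n, the index n of the range 1..n being 0.      *)

Definition KP (R : realType) (n : nat) : Type :=
  ({ffun 'Z_n * 'Z_n -> R[i]} * 'M[R[i]]_((Zp_trunc n).+2))%type.

(* (false, i, j) labels e_(i,j) and (true, i, j) labels E_(i,j) *)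
Definition KPidx (n : nat) : finType := (bool * 'Z_n * 'Z_n)%type.

(* C(KP_n) (x) C(KP_n), in coordinates on the basis of products of basis      *)
(* vectors                                                                    *)
Definition KP2 (R : realType) (n : nat) : Type :=
  {ffun KPidx n * KPidx n -> R[i]}.

HB.instance Definition _ (R : realType) (n : nat) :=
  GRing.PzRing.copy (KP R n)
    ({ffun 'Z_n * 'Z_n -> R[i]} * 'M[R[i]]_((Zp_trunc n).+2))%type.
HB.instance Definition _ (R : realType) (n : nat) :=
  GRing.Lmodule.copy (KP R n)
    ({ffun 'Z_n * 'Z_n -> R[i]} * 'M[R[i]]_((Zp_trunc n).+2))%type.
HB.instance Definition _ (R : realType) (n : nat) :=
  GRing.Lmodule.copy (KP2 R n) {ffun KPidx n * KPidx n -> R[i]}.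

Section Sekine.
Variables (R : realType) (n : nat).
Local Notation C := (R[i]).
Local Notation A := (KP R n).
Local Notation A2 := (KP2 R n).
Local Notation Z := ('Z_n).
Implicit Types (x y p : A) (t : A2) (b : KPidx n) (phi psi : {scalar A}).

Definition eta : C := cos (2 * pi / n%:R) +i* sin (2 * pi / n%:R).

(* the exponent is the representative of k in 0..n-1; eta ^+ n = 1 *)
Definition etaX (k : Z) : C := eta ^+ k.

Definition e_ (i j : Z) : A := ([ffun ij => (ij == (i, j))%:R], 0).
Definition E_ (i j : Z) : A := (0, delta_mx i j).

Definition kp_star x : A := ([ffun ij => ((x.1 ij)^*)%R], x.2 ^t*).

Definition kp_coef x b : C :=
  let: (m, i, j) := b in if m then x.2 i j else x.1 (i, j).

Definition kp_basis b : A := let: (m, i, j) := b in if m then E_ i j else e_ i j.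

Definition tens x y : A2 :=
  [ffun bc : KPidx n * KPidx n => kp_coef x bc.1 * kp_coef y bc.2].

Definition Delta_e (i j : Z) : A2 :=
  \sum_(s : Z) \sum_(t : Z) tens (e_ s t) (e_ (i - s) (j - t)) +
  n%:R^-1 *: \sum_(m : Z) \sum_(r : Z)
    etaX (i * (m - r)) *: tens (E_ m r) (E_ (m + j) (r + j)).

Definition Delta_E (i j : Z) : A2 :=
  \sum_(s : Z) \sum_(t : Z)
    etaX (s * (i - j)) *: tens (e_ (- s) (- t)) (E_ (i - t) (j - t)) +
  \sum_(s : Z) \sum_(t : Z)
    etaX (s * (j - i)) *: tens (E_ (i - t) (j - t)) (e_ s t).

Definition Delta x : A2 :=
  \sum_(i : Z) \sum_(j : Z) x.1 (i, j) *: Delta_e i j +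
  \sum_(i : Z) \sum_(j : Z) x.2 i j *: Delta_E i j.

Definition tens_fun phi psi t : C :=
  \sum_(bc : KPidx n * KPidx n)
    t bc * (phi (kp_basis bc.1) * psi (kp_basis bc.2)).

Lemma kp_coef_is_linear b : scalar (kp_coef^~ b).
Proof.
by case: b => [[[] i] j] a x y /=; rewrite !(ffunE, mxE).
Qed.

Lemma kp_coef_basis b b' : kp_coef (kp_basis b') b = (b == b')%:R.
Proof.
by case: b b' => [[[] i] j] [[[] k] l] /=; rewrite ?ffunE ?mxE ?xpair_eqE.
Qed.

Lemma kp_coef_inj x y : kp_coef x =1 kp_coef y -> x = y.
Proof.
case: x y => [f X] [g Y] xy; apply/pair_equal_spec; split.
  by apply/ffunP => -[i j]; exact: (xy (false, i, j)).
by apply/matrixP => i j; exact: (xy (true, i, j)).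
Qed.

Lemma kp_decomp x : x = \sum_(b : KPidx n) kp_coef x b *: kp_basis b.
Proof.
apply: kp_coef_inj => b.
have coefD : {morph kp_coef^~ b : y z / y + z}.
  by move=> y z; have := kp_coef_is_linear b 1 y z; rewrite scale1r mul1r.
have coef0 : kp_coef 0 b = 0.
  by apply: (addrI (kp_coef 0 b)); rewrite -coefD !addr0.
have coefZ c y : kp_coef (c *: y) b = c * kp_coef y b.
  by have := kp_coef_is_linear b c y 0; rewrite coef0 !addr0.
rewrite (big_morph _ coefD coef0) (bigD1 b) //= coefZ kp_coef_basis eqxx mulr1.
rewrite big1 ?addr0 // => b' b'b.
by rewrite coefZ kp_coef_basis eq_sym (negPf b'b) mulr0.
Qed.

Lemma tens_fun_tens phi psi x y : tens_fun phi psi (tens x y) = phi x * psi y.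
Proof.
rewrite {2}[x]kp_decomp {2}[y]kp_decomp !linear_sum big_distrlr /=.
rewrite pair_big /=; apply: eq_bigr => bc _; rewrite ffunE !linearZ /=.
by rewrite mulrACA.
Qed.

Lemma Delta_is_linear : linear Delta.
Proof.
move=> a x y; rewrite /Delta scalerDr addrACA.
congr (_ + _); rewrite scaler_sumr -big_split /=; apply: eq_bigr => i _;
  rewrite scaler_sumr -big_split /=; apply: eq_bigr => j _.
  by rewrite !ffunE scalerDl scalerA.
by rewrite !mxE scalerDl scalerA.
Qed.

Lemma tens_fun_is_linear phi psi : scalar (tens_fun phi psi).
Proof.
move=> a s t; rewrite /tens_fun mulr_sumr -big_split /=.
by apply: eq_bigr => bc _; rewrite !ffunE mulrDl; congr (_ + _); rewrite [RHS]mulrA.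
Qed.

Definition conv_fun phi psi x : C := tens_fun phi psi (Delta x).

Lemma conv_is_linear phi psi : scalar (conv_fun phi psi).
Proof.
by move=> a x y; rewrite /conv_fun Delta_is_linear tens_fun_is_linear.
Qed.

HB.instance Definition _ phi psi :=
  GRing.isLinear.Build C A C *%R (conv_fun phi psi) (conv_is_linear phi psi).

Definition conv phi psi : {scalar A} := conv_fun phi psi.

Definition counit_fun x : C := x.1 (0, 0).

Lemma counit_is_linear : scalar counit_fun.
Proof. by move=> a x y; rewrite /counit_fun !ffunE. Qed.

HB.instance Definition _ :=
  GRing.isLinear.Build C A C *%R counit_fun counit_is_linear.

Definition counit : {scalar A} := counit_fun.

Definition conv_pow phi (k : nat) : {scalar A} := iter k (conv phi) counit.

Definition haar_fun x : C :=
  (2 * n%:R ^+ 2)^-1 *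
  (\sum_(i : Z) \sum_(j : Z) x.1 (i, j) + n%:R * \sum_(i : Z) x.2 i i).

Lemma haar_is_linear : scalar haar_fun.
Proof.
move=> a x y; rewrite /haar_fun [a * _]mulrCA -[RHS]mulrDr; congr (_ * _).
rewrite [a * _]mulrDr [a * (n%:R * _)]mulrCA addrACA -[in RHS]mulrDr.
congr (_ + _ * _); rewrite mulr_sumr -big_split /=; apply: eq_bigr => i _;
  last by rewrite !mxE.
by rewrite mulr_sumr -big_split; apply: eq_bigr => j _; rewrite !ffunE.
Qed.

HB.instance Definition _ :=
  GRing.isLinear.Build C A C *%R haar_fun haar_is_linear.

Definition haar : {scalar A} := haar_fun.

Definition fourier_fun x y : C := haar (y * x).

Lemma fourier_is_linear x : scalar (fourier_fun x).
Proof.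
move=> a y z; rewrite /fourier_fun mulrDl linearD; congr (_ + _).
rewrite -[RHS]linearZ; congr (haar _); apply/pair_equal_spec; split => /=.
  by apply/ffunP => ij; rewrite !ffunE [in RHS]/GRing.scale /= mulrA.
exact: (esym (scalemxAl a y.2 x.2)).
Qed.

HB.instance Definition _ x :=
  GRing.isLinear.Build C A C *%R (fourier_fun x) (fourier_is_linear x).

Definition fourier x : {scalar A} := fourier_fun x.

Definition is_state phi : Prop :=
  (forall x, 0 <= phi (kp_star x * x)) /\ phi 1 = 1.

Definition is_projection p : Prop := p * p = p /\ kp_star p = p.

Definition qtv phi psi : R :=
  sup [set Normc.normc (phi p - psi p) | p in [set p | is_projection p]].

End Sekine.

(* Irr n labels I(KP_n); the boolean is the sign, true for +, and Xi u v      *)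
(* stands for the two-dimensional representation of parameters u and v + 1.   *)
(* Sigma requires n even, so that (-1)^m below makes sense for m modulo n.    *)
Inductive Irr (n : nat) : Type :=
| Rho of 'Z_n & bool
| Xi of 'Z_n & 'I_(n.-1)./2
| Sigma of ~~ odd n & 'Z_n & bool.

Definition Irr_code (n : nat) (al : Irr n) :
    'Z_n * bool + 'Z_n * 'I_(n.-1)./2 + {: {_ : unit | ~~ odd n} * 'Z_n * bool} :=
  match al with
  | Rho l s => inl (inl (l, s))
  | Xi u v => inl (inr (u, v))
  | Sigma h l s => inr (exist _ tt h, l, s)
  end.

Definition Irr_decode (n : nat)
    (c : 'Z_n * bool + 'Z_n * 'I_(n.-1)./2 +
         {: {_ : unit | ~~ odd n} * 'Z_n * bool}) : Irr n :=
  match c with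
  | inl (inl (l, s)) => Rho l s
  | inl (inr (u, v)) => Xi u v
  | inr (exist _ h, l, s) => Sigma h l s
  end.

Lemma Irr_codeK (n : nat) : cancel (@Irr_code n) (@Irr_decode n).
Proof. by case. Qed.

HB.instance Definition _ (n : nat) :=
  Finite.copy (Irr n) (can_type (@Irr_codeK n)).

Definition irr_dim (n : nat) (al : Irr n) : nat :=
  if al is Xi _ _ then 2%N else 1%N.

Definition bsign (C : pzRingType) (s : bool) : C := if s then 1 else -1.

Definition irr_char (R : realType) (n : nat) (al : Irr n) : KP R n :=
  match al with
  | Rho l s =>
      \sum_(i : 'Z_n) \sum_(j : 'Z_n) etaX R (i * l) *: e_ R i j +
      bsign R[i] s *: \sum_(m : 'Z_n) E_ R m (m + l)
  | Xi u v =>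
      2 *: \sum_(s : 'Z_n) \sum_(t : 'Z_n)
        (etaX R (s * u) * (cos (2 * t%:R * v.+1%:R * pi / n%:R))%:C) *: e_ R s t
  | Sigma _ l s =>
      \sum_(i : 'Z_n) \sum_(j : 'Z_n)
        ((-1) ^+ j * etaX R (i * l)) *: e_ R i j +
      bsign R[i] s *: \sum_(m : 'Z_n) (-1) ^+ m *: E_ R m (m + l)
  end.

(* Main.v *)
(* Every non-trivial irreducible alpha supplies a normal partial isometry w
   for which all convolution powers of F(a) are multiplicative: the adjoint
   of the group-like rho or sigma in dimension one, the adjoint of a
   diagonal matrix coefficient in dimension two, where F(a) kills the
   off-diagonal coefficients because a is a combination of characters. By
   orthogonality F(a) w = a_alpha / d_alpha and the Haar state kills w, so
   the difference f of F(a)^k and Haar takes at w the value (a_alpha /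
   d_alpha)^k. Diagonalizing w with orthogonal projections p_i and
   coefficients of modulus at most 1 gives |f w| <= sum_i |f p_i|. As f is
   hermitian the f p_i are real, and this sum is the value of f at the sum
   of the p_i with f p_i >= 0 minus its value at the sum of the other ones. *)
Require Import Defs.
From mathcomp Require Import all_boot all_order all_algebra complex.
From mathcomp Require Import all_classical all_reals all_analysis.
From mathcomp Require Import ring lra zify.
Import Order.TTheory GRing.Theory Num.Theory ComplexField.
Set Implicit Arguments.
Unset Strict Implicit.
Unset Printing Implicit Defensive.
Local Open Scope ring_scope.
Local Open Scope sesquilinear_scope.

(** * Powers of [eta] as characters of Z/n *)

Section RootsOfUnity.
Variables (R : realType) (m : nat).
Local Notation n := m.+2.
Local Notation C := R[i].
Local Notation Z := 'Z_n.
Local Notation "'η'" := (etaX R (n := n)).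

(** De Moivre's formula. It serves for [eta ^+ n = 1], for the primitivity of [eta] and for the
    cosines in the characters of [Xi]. *)
Lemma etaE k :
  eta R n ^+ k =
  (cos (k%:R * (2 * pi / n%:R)) +i* sin (k%:R * (2 * pi / n%:R)))%C.
Proof.
rewrite /eta; move: (2 * pi / _) => x.
elim: k => [|k IH]; first by rewrite mul0r cos0 sin0.
rewrite exprS IH -natr1 mulrDl mul1r cosD sinD; apply/eqP; rewrite eq_complex /=.
by apply/andP; split; apply/eqP; ring.
Qed.

Lemma eta_expn : eta R n ^+ n = 1.
Proof.
rewrite etaE mulrC divfK ?pnatr_eq0 //.
by rewrite mulr_natl cos2pi sin2pi.
Qed.

Lemma etaX_mod k : η (inZp k) = eta R n ^+ k.
Proof.
rewrite /etaX /= [in RHS](divn_eq k n) exprD mulnC exprM.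
by rewrite eta_expn expr1n mul1r.
Qed.

Lemma etaXD (i j : Z) : η (i + j) = η i * η j.
Proof. by rewrite -exprD -etaX_mod; congr (η _); apply: val_inj. Qed.

Lemma etaX_neq0 (i : Z) : η i != 0.
Proof.
apply/negP => /eqP i0; have := etaXD i (- i).
by rewrite i0 mul0r subrr => /eqP; rewrite oner_eq0.
Qed.

Lemma etaXN (i : Z) : η (- i) = (η i)^-1.
Proof.
by apply: (mulIf (etaX_neq0 i)); rewrite mulVf ?etaX_neq0 // -etaXD addNr.
Qed.

Lemma norm_etaX (i : Z) : `|η i| = 1.
Proof.
apply: (pexpIrn (n := n)) => //; rewrite ?nnegrE //.
by rewrite -normrX -exprM mulnC exprM eta_expn !expr1n normr1.
Qed.

Lemma conj_etaX (i : Z) : (η i)^* = η (- i).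
Proof. by rewrite etaXN invC_norm norm_etaX expr1n invr1 mul1r. Qed.

(** Primitivity of [eta]: if cos(2 pi i / n) = 1, the half-angle formula forces sin(pi i / n) = 0,
    whereas pi i / n lies strictly between 0 and pi when 0 < i < n. *)
Lemma etaX_eq1 (i : Z) : (η i == 1) = (i == 0).
Proof.
apply/eqP/eqP => [|->//]; rewrite /etaX etaE => -[c1 _]; apply/val_inj/eqP => /=.
rewrite -leqn0 leqNgt; apply/negP => i_gt0.
have : 0 < sin (i%:R * (pi / n%:R)) :> R.
  apply: sin_gt0_pi; apply/andP; split.
    by rewrite mulr_gt0 ?divr_gt0 ?pi_gt0 ?ltr0n.
  rewrite mulrC -mulrA gtr_pMr ?pi_gt0 // mulrC ltr_pdivrMr ?ltr0n //.
  by rewrite mul1r ltr_nat; exact: (ltn_ord i).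
suff -> : sin (i%:R * (pi / n%:R)) = 0 :> R by rewrite ltxx.
apply/eqP; rewrite -sqrf_eq0; apply/eqP.
move: c1; have -> : i%:R * (2 * pi / n%:R) = (i%:R * (pi / n%:R)) *+ 2 :> R.
  by move: (n%:R^-1) => c; ring.
by rewrite cos_mulr2n sin2cos2 mulr2n; lra.
Qed.

(** Shifting i by 1 multiplies the sum by [η k], so the sum is killed by [η k - 1], which is nonzero
    unless k = 0. *)
Lemma sum_etaX (k : Z) : \sum_(i : Z) η (i * k) = n%:R * (k == 0)%:R.
Proof.
have [->|k0] := eqVneq k 0.
  rewrite mulr1 (eq_bigr (fun=> 1)); last by move=> i _; rewrite mulr0.
  by rewrite sumr_const card_ord.
rewrite mulr0; apply/eqP.
suff : (η k - 1) * \sum_(i : Z) η (i * k) == 0.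
  by rewrite mulf_eq0 subr_eq0 etaX_eq1 (negPf k0).
rewrite mulrBl mul1r mulr_sumr subr_eq0; apply/eqP.
rewrite [RHS](reindex_inj (addrI 1)) /=; apply: eq_bigr => i _.
by rewrite mulrDl mul1r etaXD.
Qed.

End RootsOfUnity.

(** * Functionals and their convolution in coordinates *)

(** Stated for a bare proof of [scalar f], so that it applies to [tens_fun], which carries no
    bundled linear structure. *)
Lemma scalar_morphisms (K : pzRingType) (V : lmodType K) (f : V -> K) :
  scalar f ->
  [/\ {morph f : x y / x + y}, forall c, {morph f : x / c *: x >-> c * x} &
      forall (I : finType) (F : I -> V), f (\sum_i F i) = \sum_i f (F i)].
Proof.
move=> fL; have fD : {morph f : x y / x + y}.
  by move=> x y; rewrite -[x in LHS]scale1r fL mul1r.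
have f0 : f 0 = 0 by apply: (addrI (f 0)); rewrite -fD !addr0.
split=> // [c x|I F]; last exact: (big_morph _ fD f0).
by rewrite -[c *: x]addr0 fL f0 addr0.
Qed.

Lemma sum_delta2 (K : pzRingType) (V : lmodType K) (I J : finType)
    (F : I -> J -> V) i j :
  \sum_k \sum_l ((k == i) && (l == j))%:R *: F k l = F i j.
Proof.
rewrite (bigD1 i) //= (bigD1 j) //= !eqxx scale1r.
rewrite !big1 ?addr0 //= => [k /negPf ki|l /negPf lj].
  by rewrite big1 // => l _; rewrite ki scale0r.
by rewrite lj scale0r.
Qed.

Section Coordinates.
Variables (R : realType) (n : nat).
Local Notation C := R[i].
Local Notation Z := 'Z_n.
Local Notation A := (KP R n).
Implicit Types (x y : A) (phi psi : {scalar A}).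

Lemma kp_decomp_sum x :
  x = \sum_(i : Z) \sum_(j : Z) x.1 (i, j) *: e_ R i j +
      \sum_(i : Z) \sum_(j : Z) x.2 i j *: E_ R i j.
Proof.
rewrite {1}[x]kp_decomp.
rewrite (eq_bigr (fun b : KPidx n =>
    kp_coef x (b.1.1, b.1.2, b.2) *: kp_basis R (b.1.1, b.1.2, b.2)));
  last by case=> [[]].
rewrite -(pair_bigA _ (fun (ab : bool * Z) (j : Z) =>
  kp_coef x (ab.1, ab.2, j) *: kp_basis R (ab.1, ab.2, j))) /=.
rewrite -(pair_bigA _ (fun (b : bool) (i : Z) =>
  \sum_(j : Z) kp_coef x (b, i, j) *: kp_basis R (b, i, j))) /=.
by rewrite big_bool /= addrC.
Qed.

Lemma scalar_coord phi x :
  phi x = \sum_(i : Z) \sum_(j : Z) x.1 (i, j) * phi (e_ R i j) +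
          \sum_(i : Z) \sum_(j : Z) x.2 i j * phi (E_ R i j).
Proof.
rewrite {1}[x]kp_decomp_sum linearD !linear_sum; congr (_ + _);
  by apply: eq_bigr => i _; rewrite linear_sum; apply: eq_bigr => j _; rewrite linearZ.
Qed.

Lemma sum_eE (c : Z -> Z -> C) :
  \sum_(i : Z) \sum_(j : Z) c i j *: e_ R i j =
  ([ffun ij => c ij.1 ij.2], 0) :> A.
Proof.
rewrite [RHS]kp_decomp_sum /= [X in _ + X]big1 ?addr0.
  by apply: eq_bigr => i _; apply: eq_bigr => j _; rewrite ffunE.
by move=> i _; rewrite big1 // => j _; rewrite mxE scale0r.
Qed.

Lemma sum_EE (c : Z -> Z -> C) :
  \sum_(i : Z) \sum_(j : Z) c i j *: E_ R i j = (0, \matrix_(i, j) c i j) :> A.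
Proof.
rewrite [RHS]kp_decomp_sum /= [X in X + _]big1 ?add0r.
  by apply: eq_bigr => i _; apply: eq_bigr => j _; rewrite mxE.
by move=> i _; rewrite big1 // => j _; rewrite ffunE scale0r.
Qed.

Lemma Delta_basis_e (i j : Z) : Delta (e_ R i j : A) = Delta_e R (n := n) i j.
Proof.
transitivity (\sum_(k : Z) \sum_(l : Z)
    ((k == i) && (l == j))%:R *: Delta_e R (n := n) k l); last exact: sum_delta2.
rewrite /Delta [X in _ + X]big1 => [|k _]; last first.
  by apply: big1 => l _; rewrite mxE scale0r.
rewrite addr0; apply: eq_bigr => k _; apply: eq_bigr => l _.
by rewrite ffunE xpair_eqE.
Qed.

Lemma Delta_basis_E (i j : Z) : Delta (E_ R i j : A) = Delta_E R (n := n) i j.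
Proof.
transitivity (\sum_(k : Z) \sum_(l : Z)
    ((k == i) && (l == j))%:R *: Delta_E R (n := n) k l); last exact: sum_delta2.
rewrite /Delta [X in X + _]big1 => [|k _]; last first.
  by apply: big1 => l _; rewrite ffunE scale0r.
rewrite add0r; apply: eq_bigr => k _; apply: eq_bigr => l _.
by rewrite mxE.
Qed.

(** The coproduct enters all later arguments only through this formula and [conv_E]. *)
Lemma conv_e phi psi (i j : Z) :
  Defs.conv phi psi (e_ R i j) =
  \sum_(s : Z) \sum_(t : Z) phi (e_ R s t) * psi (e_ R (i - s) (j - t)) +
  n%:R^-1 * \sum_(k : Z) \sum_(r : Z)
    etaX R (i * (k - r)) * (phi (E_ R k r) * psi (E_ R (k + j) (r + j))).
Proof.
rewrite /Defs.conv /= /conv_fun Delta_basis_e.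
have [TD TZ Tsum] := scalar_morphisms (@tens_fun_is_linear R n phi psi).
rewrite /Delta_e TD TZ !Tsum.
congr (_ + _ * _); apply: eq_bigr => s _; rewrite Tsum; apply: eq_bigr => t _.
  by rewrite tens_fun_tens.
by rewrite TZ tens_fun_tens.
Qed.

Lemma conv_E phi psi (i j : Z) :
  Defs.conv phi psi (E_ R i j) =
  \sum_(s : Z) \sum_(t : Z) etaX R (s * (i - j)) *
    (phi (e_ R (- s) (- t)) * psi (E_ R (i - t) (j - t))) +
  \sum_(s : Z) \sum_(t : Z) etaX R (s * (j - i)) *
    (phi (E_ R (i - t) (j - t)) * psi (e_ R s t)).
Proof.
rewrite /Defs.conv /= /conv_fun Delta_basis_E.
have [TD TZ Tsum] := scalar_morphisms (@tens_fun_is_linear R n phi psi).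
rewrite /Delta_E TD !Tsum.
congr (_ + _); apply: eq_bigr => s _; rewrite Tsum; apply: eq_bigr => t _;
  by rewrite TZ tens_fun_tens.
Qed.

End Coordinates.

(** * Two-by-two corepresentations and convolution *)

Section MatrixCoefficients.
Variables (R : realType) (m : nat).
Local Notation n := m.+2.
Local Notation C := R[i].
Local Notation Z := 'Z_n.
Local Notation A := (KP R n).
Local Notation "'η'" := (etaX R (n := n)).
Implicit Types (x y : A) (phi psi : {scalar A}) (u v : Z).

(* For fixed [u] and [v], the matrix with rows [(kpg u v, kph u (- v))] and
   [(kph u v, kpg u (- v))] is a corepresentation of KP_n. *)
Definition kpg u v : A := ([ffun ij => η (ij.1 * u + ij.2 * v)], 0).
Definition kph u v : A := (0, \matrix_(i, j) (η (i * v) * (j == i + u)%:R)).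

Lemma scalar_kpg phi u v :
  phi (kpg u v) = \sum_(i : Z) \sum_(j : Z) η (i * u + j * v) * phi (e_ R i j).
Proof.
rewrite scalar_coord [X in _ + X]big1 => [|i _]; last first.
  by apply: big1 => j _; rewrite mxE mul0r.
by rewrite addr0; apply: eq_bigr => i _; apply: eq_bigr => j _; rewrite ffunE.
Qed.

Lemma scalar_kph phi u v :
  phi (kph u v) = \sum_(i : Z) η (i * v) * phi (E_ R i (i + u)).
Proof.
rewrite scalar_coord [X in X + _]big1 => [|i _]; last first.
  by apply: big1 => j _; rewrite ffunE mul0r.
rewrite add0r; apply: eq_bigr => i _; rewrite (bigD1 (i + u)) //=.
rewrite mxE eqxx mulr1 big1 ?addr0 // => j /negPf ju.
by rewrite mxE ju mulr0 mul0r.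
Qed.

(** The coproduct of the upper left entry of the corepresentation. The first term reflects that (s,
    t) -> [η (s * u + t * v)] is a character of the group of pairs; the second comes from the matrix
    block. *)
Lemma conv_kpg phi psi u v :
  Defs.conv phi psi (kpg u v) =
  phi (kpg u v) * psi (kpg u v) + phi (kph u (- v)) * psi (kph u v).
Proof.
rewrite !scalar_kpg !scalar_kph.
under eq_bigr => i _ do under eq_bigr => j _ do rewrite conv_e mulrDr.
under eq_bigr => i _ do rewrite big_split /=.
rewrite big_split /=; congr (_ + _).
  rewrite mulr_suml.
  transitivity (\sum_(i : Z) \sum_(s : Z) \sum_(j : Z) \sum_(t : Z)
    η (i * u + j * v) * (phi (e_ R s t) * psi (e_ R (i - s) (j - t)))).
    apply: eq_bigr => i _; rewrite exchange_big /=; apply: eq_bigr => j _.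
    by rewrite mulr_sumr; apply: eq_bigr => s _; rewrite mulr_sumr.
  rewrite exchange_big /=; apply: eq_bigr => s _.
  rewrite mulr_suml (reindex_inj (addIr s)) /=.
  under [RHS]eq_bigr => t _ do rewrite mulr_sumr.
  rewrite [RHS]exchange_big /=; apply: eq_bigr => i _.
  rewrite exchange_big /=; apply: eq_bigr => t _.
  rewrite (reindex_inj (addIr t)) mulr_sumr /=; apply: eq_bigr => j _.
  by rewrite !addrK !mulrDl !etaXD; ring.
transitivity (\sum_(j : Z) \sum_(k : Z)
    η (j * v) * (phi (E_ R k (k + u)) * psi (E_ R (k + j) (k + j + u)))).
  rewrite exchange_big /=; apply: eq_bigr => j _.
  (* The sum over i is isolated: it equals n when r = k + u and vanishes otherwise, which absorbs
     the factor 1/n of the coproduct. *)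
  transitivity (\sum_(k : Z) \sum_(r : Z) η (j * v) *
    (phi (E_ R k r) * psi (E_ R (k + j) (r + j))) *
    (n%:R^-1 * \sum_(i : Z) η (i * (u + k - r)))).
    under eq_bigr => i _ do rewrite !mulr_sumr.
    rewrite exchange_big /=; apply: eq_bigr => k _.
    under eq_bigr => i _ do rewrite !mulr_sumr.
    rewrite exchange_big /=; apply: eq_bigr => r _.
    rewrite !mulr_sumr; apply: eq_bigr => i _.
    by rewrite -addrA (mulrDr i u) !etaXD; ring.
  apply: eq_bigr => k _; rewrite (bigD1 (k + u)) //= addrC big1 => [|r rku].
    rewrite sum_etaX add0r [u + k]addrC subrr eqxx mulr1 mulVf ?pnatr_eq0 // mulr1.
    by rewrite -!addrA [u + j]addrC.
  by rewrite sum_etaX [u + k]addrC subr_eq0 eq_sym (negPf rku) !mulr0.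
rewrite exchange_big mulr_suml /=; apply: eq_bigr => k _.
(* With q = k + j, the weight [η (j * v)] splits into [η (k * - v)] and [η (q * v)]; hence the
   frequency -v in the left factor. *)
rewrite mulr_sumr (reindex_inj (addrI (- k))) /=; apply: eq_bigr => q _.
by rewrite addNKr mulrDl !etaXD mulrN -mulNr; ring.
Qed.

(** The coproduct of the lower left entry of the corepresentation. *)
Lemma conv_kph phi psi u v :
  Defs.conv phi psi (kph u v) =
  phi (kpg u (- v)) * psi (kph u v) + phi (kph u v) * psi (kpg u v).
Proof.
rewrite !scalar_kpg !scalar_kph.
under eq_bigr => i _ do rewrite conv_E mulrDr.
rewrite big_split /=; congr (_ + _).
  transitivity (\sum_(s : Z) \sum_(t : Z) \sum_(p : Z) η (s * u + t * - v) *
      phi (e_ R s t) * (η (p * v) * psi (E_ R p (p + u)))).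
    (* Negating s, and then t, turns the left leg e_(-s,-t) into e_(s,t); the later translation of p
       by -t produces the weight [η (t * - v)]. *)
    under eq_bigr => p _ do rewrite mulr_sumr (reindex_inj oppr_inj).
    rewrite exchange_big /=; apply: eq_bigr => s _.
    under eq_bigr => p _ do rewrite mulr_sumr (reindex_inj oppr_inj).
    rewrite exchange_big /=; apply: eq_bigr => t _.
    rewrite (reindex_inj (addrI (- t))) /=; apply: eq_bigr => p _.
    have -> : - t + p - (- t + p + u) = - u by ring.
    have -> : - t + p - - t = p by ring.
    have -> : - t + p + u - - t = p + u by ring.
    by rewrite !opprK mulrNN mulrDl !etaXD mulrN -mulNr; ring.
  rewrite mulr_suml; apply: eq_bigr => s _.
  by rewrite mulr_suml; apply: eq_bigr => t _; rewrite mulr_sumr.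
transitivity (\sum_(s : Z) \sum_(t : Z) \sum_(p : Z)
    η (p * v) * phi (E_ R p (p + u)) * (η (s * u + t * v) * psi (e_ R s t))).
  under eq_bigr => p _ do rewrite mulr_sumr.
  rewrite exchange_big /=; apply: eq_bigr => s _.
  under eq_bigr => p _ do rewrite mulr_sumr.
  rewrite exchange_big /=; apply: eq_bigr => t _.
  rewrite (reindex_inj (addrI t)) /=; apply: eq_bigr => p _.
  have -> : t + p + u - (t + p) = u by ring.
  have -> : t + p + u - t = p + u by ring.
  by rewrite [t + p]addrC addrK mulrDl !etaXD; ring.
rewrite mulr_sumr; apply: eq_bigr => s _.
by rewrite mulr_sumr; apply: eq_bigr => t _; rewrite mulr_suml.
Qed.

End MatrixCoefficients.

(** * Haar pairings of the matrix coefficients *)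

Section Pairings.
Variables (R : realType) (m : nat).
Local Notation n := m.+2.
Local Notation C := R[i].
Local Notation Z := 'Z_n.
Local Notation A := (KP R n).
Local Notation "'η'" := (etaX R (n := n)).
Implicit Types (x y : A) (u v : Z).

Lemma haar_mul x y :
  haar R n (x * y) =
  (2 * n%:R ^+ 2)^-1 * (\sum_(i : Z) \sum_(j : Z) x.1 (i, j) * y.1 (i, j) +
    n%:R * \sum_(i : Z) \sum_(j : Z) x.2 i j * y.2 j i).
Proof.
rewrite /haar /= /haar_fun; congr (_ * (_ + _ * _)).
  by apply: eq_bigr => i _; apply: eq_bigr => j _; rewrite ffunE.
by apply: eq_bigr => i _; rewrite mxE.
Qed.

(** Orthogonality of the characters of the group of pairs; 1/2 is n^2 / (2 n^2). *)
Lemma haar_kpg_kpg u v u' v' :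
  haar R n (kpg R u v * kpg R u' v') = 2^-1 * ((u + u' == 0) && (v + v' == 0))%:R.
Proof.
rewrite haar_mul [X in _ + _ * X]big1 ?mulr0 ?addr0 => [|i _]; last first.
  by apply: big1 => j _; rewrite mxE mul0r.
transitivity ((2 * n%:R ^+ 2)^-1 *
    ((\sum_(i : Z) η (i * (u + u'))) * (\sum_(j : Z) η (j * (v + v'))))).
  rewrite big_distrlr /=; congr (_ * _).
  apply: eq_bigr => i _; apply: eq_bigr => j _; rewrite !ffunE /= -!etaXD.
  by congr (η _); ring.
rewrite !sum_etaX -mulnb natrM.
have : n%:R != 0 :> C by rewrite pnatr_eq0.
by move: (n%:R : C) => N N0; field.
Qed.

(** The product of two weighted shifts has a nonzero diagonal only if the shifts are opposite; its
    trace is then a geometric sum, and n * n / (2 n^2) gives 1/2 again. *)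
Lemma haar_kph_kph u v u' v' :
  haar R n (kph R u v * kph R u' v') =
  2^-1 * (η (u * v') * ((u + u' == 0) && (v + v' == 0))%:R).
Proof.
rewrite haar_mul [X in X + _]big1 ?add0r => [|i _]; last first.
  by apply: big1 => j _; rewrite ffunE mul0r.
transitivity ((2 * n%:R ^+ 2)^-1 * (n%:R * (η (u * v') *
    (u + u' == 0)%:R * (\sum_(j : Z) η (j * (v + v')))))).
  congr (_ * (_ * _)); rewrite mulr_sumr; apply: eq_bigr => i _.
  rewrite (bigD1 (i + u)) //= !mxE eqxx big1 => [|j /negPf ju]; last first.
    by rewrite mxE ju mulr0 mul0r.
  rewrite -addrA -[X in X == _]addr0 (inj_eq (addrI i)) eq_sym.
  by rewrite mulr1 (mulrDr i v) (mulrDl i u v') !etaXD; ring.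
rewrite !sum_etaX -mulnb natrM.
have : n%:R != 0 :> C by rewrite pnatr_eq0.
by move: (n%:R : C) => N N0; field.
Qed.

Lemma haar_kpg_kph u v u' v' : haar R n (kpg R u v * kph R u' v') = 0.
Proof.
rewrite haar_mul !big1 ?mulr0 ?addr0 ?mulr0 // => i _; apply: big1 => j _.
  by rewrite mxE mul0r.
by rewrite [X in _ * X]ffunE mulr0.
Qed.

Lemma haar_kph_kpg u v u' v' : haar R n (kph R u v * kpg R u' v') = 0.
Proof.
rewrite haar_mul !big1 ?mulr0 ?addr0 ?mulr0 // => i _; apply: big1 => j _.
  by rewrite [X in _ * X]mxE mulr0.
by rewrite ffunE mul0r.
Qed.

End Pairings.

(** * Irreducible characters and their orthogonality *)

Section Characters.
Variables (R : realType) (m : nat).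
Local Notation n := m.+2.
Local Notation C := R[i].
Local Notation Z := 'Z_n.
Local Notation A := (KP R n).
Local Notation "'η'" := (etaX R (n := n)).
Implicit Types (x y : A) (u v l : Z) (s : bool).

Definition freqXi (v : 'I_(n.-1)./2) : Z := inZp v.+1.
Definition freqSigma : Z := inZp n./2.

(** The representatives lie between 1 and (n-1)/2, so their sum lies strictly between 0 and n. Hence
    no [freqXi] is opposite to another or to itself. *)
Lemma freqXiD_neq0 (v w : 'I_(n.-1)./2) : freqXi v + freqXi w != 0.
Proof.
apply/negP => /eqP/(congr1 val) /=; rewrite modnDm.
have := ltn_ord v; have := ltn_ord w; rewrite [n.-1]/=.
move: (val v) (val w) => a b ha hb.
rewrite -[(Zp_trunc n).+2]/n modn_small; lia.
Qed.

Lemma freqXi_inj : injective freqXi.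
Proof.
move=> v w /(congr1 val) /= vw; apply: val_inj; move: vw => /=.
have := ltn_ord v; have := ltn_ord w; rewrite [n.-1]/=.
move: (nat_of_ord v) (nat_of_ord w) => a b ha hb.
rewrite -[(Zp_trunc n).+2]/n !modn_small; lia.
Qed.

Lemma freqSigma_double : ~~ odd n -> freqSigma + freqSigma = 0.
Proof.
move=> /negPf ev; apply: val_inj => /=.
by rewrite modnDm addnn -[RHS](modnn n) -{2}(odd_double_half n) ev.
Qed.

Lemma freqSigma_neq0 : freqSigma != 0.
Proof.
apply/negP => /eqP/(congr1 val) /=; rewrite -[(Zp_trunc n).+2]/n modn_small; lia.
Qed.

(** A common form for the one-dimensional representations: v = 0 gives the [Rho] family and v =
    [freqSigma] the [Sigma] family. *)
Definition kp1 l v s : A := kpg R l v + bsign C s *: kph R l v.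

Lemma kp1_sum l v s :
  \sum_(i : Z) \sum_(j : Z) η (i * l + j * v) *: e_ R i j +
    bsign C s *: (\sum_(k : Z) η (k * v) *: E_ R k (k + l)) = kp1 l v s.
Proof.
rewrite /kp1 sum_eE; congr (_ + _ *: _).
rewrite /kph -sum_EE; apply: eq_bigr => i _.
rewrite (bigD1 (i + l)) //= eqxx mulr1 big1 ?addr0 // => j /negPf jl.
by rewrite jl mulr0 scale0r.
Qed.

Lemma irr_char_Rho l s : irr_char R (Rho l s) = kp1 l 0 s.
Proof.
rewrite -kp1_sum /=; congr (_ + _ *: _).
  by apply: eq_bigr => i _; apply: eq_bigr => j _; rewrite mulr0 addr0.
by apply: eq_bigr => i _; rewrite mulr0 scale1r.
Qed.

(** [η freqSigma] is a square root of 1 different from 1, hence -1. *)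
Lemma etaX_freqSigma (k : Z) : ~~ odd n -> η (k * freqSigma) = (-1) ^+ k.
Proof.
move=> ev; have /eqP : η freqSigma ^+ 2 = 1.
  by rewrite expr2 -etaXD freqSigma_double.
rewrite sqrf_eq1 etaX_eq1 (negPf freqSigma_neq0) => /eqP <-.
rewrite -exprM -etaX_mod; congr (η _); apply: val_inj => /=.
by rewrite mulnC.
Qed.

Lemma irr_char_Sigma (ev : ~~ odd n) l s :
  irr_char R (Sigma ev l s) = kp1 l freqSigma s.
Proof.
rewrite -kp1_sum /=; congr (_ + _ *: _).
  apply: eq_bigr => i _; apply: eq_bigr => j _.
  by rewrite etaXD etaX_freqSigma // mulrC.
by apply: eq_bigr => i _; rewrite etaX_freqSigma.
Qed.

(** The trace of the two-by-two corepresentation: twice the cosine is a sum of two conjugate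
    exponentials. *)
Lemma irr_char_Xi u (v : 'I_(n.-1)./2) :
  irr_char R (Xi u v) = kpg R u (freqXi v) + kpg R u (- freqXi v).
Proof.
rewrite /= sum_eE; apply/pair_equal_spec; split; last by rewrite /= scaler0 addr0.
apply/ffunP => -[i j]; rewrite !ffunE /= !etaXD mulrN -conj_etaX -mulrDr.
rewrite [LHS]mulrCA; congr (_ * _).
have -> : j * freqXi v = inZp (j * v.+1).
  by apply: val_inj; rewrite /= modnMmr.
rewrite etaX_mod etaE natrM; apply/eqP; rewrite eq_complex /=.
have -> : 2 * j%:R * v.+1%:R * pi / n%:R = j%:R * v.+1%:R * (2 * pi / n%:R) :> R.
  by move: (n%:R^-1) => c; ring.
by apply/andP; split; apply/eqP; ring.
Qed.

Lemma haar_mulDZl (c : C) x y z :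
  haar R n ((x + c *: y) * z) = haar R n (x * z) + c * haar R n (y * z).
Proof. by rewrite addrC -[LHS]/(fourier_fun z _) fourier_is_linear addrC. Qed.

Lemma kp_mulrZ c x y : x * (c *: y) = c *: (x * y) :> A.
Proof.
apply/pair_equal_spec; split => /=; last exact: (esym (scalemxAr c x.2 y.2)).
by apply/ffunP => ij; rewrite !ffunE [in LHS]/GRing.scale /= mulrCA.
Qed.

Lemma haar_mulDZr (c : C) x y z :
  haar R n (z * (x + c *: y)) = haar R n (z * x) + c * haar R n (z * y).
Proof.
by rewrite mulrDr kp_mulrZ addrC -[LHS]/(haar_fun _) haar_is_linear addrC.
Qed.

(* The adjoint of [kp1 l v s]. *)
Definition kp1_adj l v s : A :=
  kpg R (- l) (- v) + (bsign C s * η (l * v)) *: kph R (- l) (- v).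

Lemma haar_adj_kpg l v s u w :
  haar R n (kp1_adj l v s * kpg R u w) = 2^-1 * ((l == u) && (v == w))%:R.
Proof.
rewrite haar_mulDZl haar_kph_kpg mulr0 addr0 haar_kpg_kpg.
by rewrite addrC subr_eq0 [- v + w]addrC subr_eq0 [u == l]eq_sym [w == v]eq_sym.
Qed.

Lemma haar_adj_kph l v s u w :
  haar R n (kp1_adj l v s * kph R u w) =
  2^-1 * (bsign C s * ((l == u) && (v == w))%:R).
Proof.
rewrite haar_mulDZl haar_kpg_kph add0r haar_kph_kph.
rewrite [- l + u]addrC subr_eq0 [- v + w]addrC subr_eq0.
rewrite [u == l]eq_sym [w == v]eq_sym.
have [->|] := eqVneq l u; last by rewrite /= !mulr0.
have [->|] := eqVneq v w; last by rewrite /= !mulr0.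
by rewrite !mulr1 mulNr etaXN; field; rewrite etaX_neq0.
Qed.

(** For equal frequencies, the commutative and matrix parts each contribute 1/2 up to sign: they add
    up when the signs agree and cancel otherwise. *)
Lemma haar_adj_kp1 l v s l' v' s' :
  haar R n (kp1_adj l v s * kp1 l' v' s') =
  [&& l == l', v == v' & s == s']%:R.
Proof.
rewrite haar_mulDZr haar_adj_kpg haar_adj_kph.
case: (l == l') (v == v') => [] [] /=; rewrite ?mulr0 ?addr0 //.
by case: s s' => [] [] /=; field.
Qed.

Lemma haar_kpg_kp1 u v l w s :
  haar R n (kpg R (- u) (- v) * kp1 l w s) = 2^-1 * ((u == l) && (v == w))%:R.
Proof.
rewrite haar_mulDZr haar_kpg_kph mulr0 addr0 haar_kpg_kpg.
by rewrite addrC subr_eq0 [- v + w]addrC subr_eq0 [u == _]eq_sym [v == _]eq_sym.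
Qed.

(** The test element of [al]. In the [Xi] case it is the adjoint of the upper left coefficient
    alone, a function of modulus one. *)
Definition irr_adj (al : Irr n) : A :=
  match al with
  | Rho l s => kp1_adj l 0 s
  | Xi u v => kpg R (- u) (- freqXi v)
  | Sigma _ l s => kp1_adj l freqSigma s
  end.

(** Orthogonality relations. In dimension two the test element meets only one of the two summands of
    the character, whence the value 1/2. *)
Lemma haar_irr_adj_char (al be : Irr n) :
  haar R n (irr_adj al * irr_char R be) = (irr_dim al)%:R^-1 * (al == be)%:R.
Proof.
(* The families are separated by their second frequency: 0 and, for even n, [freqSigma] are killed
   by doubling, and no [freqXi v] is. *)
have freqXi_neq (w : Z) (v : 'I_(n.-1)./2) : w + w = 0 ->
    (freqXi v == w = false) * (w == freqXi v = false).
  move=> ww; split; apply/negP => /eqP vw; move: (freqXiD_neq0 v v).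
    by rewrite vw ww eqxx.
  by rewrite -vw ww eqxx.
have freqXi_neqN (v w : 'I_(n.-1)./2) : freqXi v == - freqXi w = false.
  by rewrite -subr_eq0 opprK (negPf (freqXiD_neq0 v w)).
have neqN (w : Z) (v : 'I_(n.-1)./2) : w + w = 0 -> w == - freqXi v = false.
  move=> ww; apply/negP => /eqP vw; move: (freqXiD_neq0 v v).
  by rewrite -[_ + _]opprK opprD -vw ww oppr0 eqxx.
have S0 : 0 == freqSigma = false by rewrite eq_sym (negPf freqSigma_neq0).
rewrite -(can_eq (@Irr_codeK n)).
case: al be => [l s|u v|ev l s] [l' s'|u' v'|ev' l' s'];
  rewrite ?irr_char_Rho ?irr_char_Sigma ?irr_char_Xi /irr_adj /irr_dim.
- by rewrite haar_adj_kp1 eqxx invr1 mul1r !(inj_eq inl_inj) xpair_eqE.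
- rewrite mulrDr linearD !haar_adj_kpg freqXi_neq ?addr0 // neqN ?addr0 //.
  by rewrite !andbF !mulr0 addr0.
- by rewrite haar_adj_kp1 S0 andbF mulr0.
- by rewrite haar_kpg_kp1 freqXi_neq ?addr0 // andbF !mulr0.
- rewrite mulrDr linearD !haar_kpg_kpg.
  rewrite [- u + u']addrC subr_eq0 [- _ + freqXi v']addrC subr_eq0 -opprD oppr_eq0.
  rewrite (negPf (freqXiD_neq0 _ _)) andbF mulr0 addr0.
  rewrite (inj_eq inl_inj) (inj_eq inr_inj) xpair_eqE.
  by rewrite [u' == u]eq_sym (inj_eq freqXi_inj) [v' == v]eq_sym.
- by rewrite haar_kpg_kp1 freqXi_neq ?freqSigma_double // andbF !mulr0.
- by rewrite haar_adj_kp1 [freqSigma == _]eq_sym S0 andbF mulr0.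
- rewrite mulrDr linearD !haar_adj_kpg freqXi_neq ?freqSigma_double //.
  by rewrite neqN ?freqSigma_double // !andbF !mulr0 addr0.
- rewrite haar_adj_kp1 eqxx invr1 mul1r (inj_eq inr_inj) !xpair_eqE.
  (* The labels carry proofs of evenness, which have to be identified. *)
  by rewrite (bool_irrelevance ev ev') eqxx.
Qed.

End Characters.

(** * Values of the convolution powers at the test elements *)

Section ClassFunctions.
Variables (R : realType) (m : nat).
Local Notation n := m.+2.
Local Notation C := R[i].
Local Notation Z := 'Z_n.
Local Notation A := (KP R n).
Local Notation "'η'" := (etaX R (n := n)).
Variable a : Irr n -> C.
Local Notation x := (\sum_al a al *: irr_char R al).

Lemma haar_mul_class (w : A) :
  haar R n (w * x) = \sum_al a al * haar R n (w * irr_char R al).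
Proof.
rewrite mulr_sumr linear_sum; apply: eq_bigr => al _.
by rewrite -[_ *: _]add0r haar_mulDZr mulr0 [haar R n 0]linear0 add0r.
Qed.

Lemma fourier_irr_adj al : fourier x (irr_adj R al) = a al / (irr_dim al)%:R.
Proof.
rewrite [LHS]haar_mul_class (bigD1 al) //= big1 ?addr0 => [|be be_al].
  by rewrite [haar_fun _]haar_irr_adj_char eqxx mulr1.
by rewrite [haar_fun _]haar_irr_adj_char eq_sym (negPf be_al) !mulr0.
Qed.

(** Only one-dimensional characters have a matrix part, and their frequency w satisfies w + w = 0; a
    nonzero pairing would require v = -w. *)
Lemma fourier_kph u v : v + v != 0 -> fourier x (kph R u v) = 0.
Proof.
move=> vv; rewrite [LHS]haar_mul_class big1 // => al _.
suff -> : haar R n (kph R u v * irr_char R al) = 0 by rewrite mulr0.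
have kp1_0 l w s : w + w = 0 -> haar R n (kph R u v * kp1 R l w s) = 0.
  move=> ww; rewrite haar_mulDZr haar_kph_kpg add0r haar_kph_kph.
  rewrite addr_eq0 [v + w == 0]addr_eq0; have [vw|] := eqVneq v (- w).
    by move: vv; rewrite vw -opprD ww oppr0 eqxx.
  by rewrite andbF !mulr0.
case: al => [l s|l w|ev l s].
- by rewrite irr_char_Rho kp1_0 ?addr0.
- by rewrite irr_char_Xi mulrDr linearD !haar_kph_kpg addr0.
- by rewrite irr_char_Sigma kp1_0 ?freqSigma_double.
Qed.

(** In dimension one the test element is group-like. In dimension two the coproduct has one further
    term, whose left leg is killed by [fourier_kph]. *)
Lemma conv_irr_adj (psi : {scalar A}) al :
  Defs.conv (fourier x) psi (irr_adj R al) =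
  fourier x (irr_adj R al) * psi (irr_adj R al).
Proof.
have conv_kp1_adj l v s : v + v = 0 ->
    Defs.conv (fourier x) psi (kp1_adj R l v s) =
    fourier x (kp1_adj R l v s) * psi (kp1_adj R l v s).
  move=> vv; have vN : - v = v by apply/eqP; rewrite -subr_eq0 -opprD vv oppr0.
  have lin (f : {scalar A}) (y z : A) (c : C) : f (y + c *: z) = f y + c * f z.
    by rewrite linearD linearZ.
  rewrite /kp1_adj !lin conv_kpg conv_kph !opprK vN.
  (* [c] is a sign times [η (l * v)], so v + v = 0 gives c^2 = 1; this makes g + c h group-like. *)
  set c := bsign C s * _; have cc : c * c = 1.
    rewrite mulrACA -etaXD -mulrDr vv mulr0 mulr1.
    by case: (s); rewrite /= ?mulrNN mulr1.
  move: (fourier x _) (fourier x _) (psi _) (psi _) => p q r t.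
  transitivity (q * t + c * c * (p * r) + c * (q * r + p * t)); last by ring.
  by rewrite cc mul1r.
case: al => [l s|u v|ev l s]; first by rewrite [LHS]conv_kp1_adj ?addr0.
  rewrite conv_kpg fourier_kph ?mul0r ?addr0 // opprK.
  exact: freqXiD_neq0.
by rewrite [LHS]conv_kp1_adj ?freqSigma_double.
Qed.

Lemma conv_pow_irr_adj k al :
  conv_pow (fourier x) k (irr_adj R al) = (a al / (irr_dim al)%:R) ^+ k.
Proof.
elim: k => [|k IH]; last first.
  by rewrite [LHS]conv_irr_adj fourier_irr_adj [X in _ * X]IH exprS.
(* Power 0 is the counit, which reads the coefficient at (0, 0) and ignores the matrix part. *)
have kpg00 u v : (kpg R u v).1 (0, 0) = 1 :> C by rewrite ffunE !mul0r addr0.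
rewrite [LHS]/= /counit_fun; case: al => [l s|u v|ev l s] /=; rewrite !ffunE /=;
 rewrite ?scaler0 ?mulr0 ?addr0 !mul0r ?addr0 //.
Qed.

(** The unit is the trivial character, so this is orthogonality to it. *)
Lemma haar_irr_adj al : al != Rho 0 true -> haar R n (irr_adj R al) = 0.
Proof.
move=> al0; rewrite -[irr_adj R al]mulr1.
have -> : 1 = irr_char R (Rho 0 true) :> A.
  rewrite irr_char_Rho /kp1 scale1r; apply/pair_equal_spec; split => /=.
    by apply/ffunP => ij; rewrite !ffunE !mulr0 addr0 addr0.
  by apply/matrixP => i j; rewrite !mxE add0r addr0 mulr0 mul1r eq_sym.
by rewrite haar_irr_adj_char (negPf al0) mulr0.
Qed.

End ClassFunctions.

(** * Hermitian functionals *)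

Lemma conj_of_realD (C : numClosedFieldType) (p q : C) :
  p + q \is Num.real -> 'i * p - 'i * q \is Num.real -> q = p^*.
Proof.
move=> /CrealP; rewrite rmorphD /= => pq /CrealP.
rewrite rmorphB !rmorphM /= conjCi => ipq.
have i0 : 'i != 0 :> C by exact: neq0Ci.
have {}ipq : q^* - p^* = p - q by apply: (mulfI i0); rewrite !mulrBr -ipq; ring.
apply: (inv_inj (@conjCK _)); rewrite conjCK.
have -> : q^* = 2^-1 * ((p^* + q^*) + (q^* - p^*)) by field.
by rewrite pq ipq; field.
Qed.

Section Hermitian.
Variables (R : realType) (n : nat).
Local Notation C := R[i].
Local Notation Z := 'Z_n.
Local Notation A := (KP R n).
Implicit Types (x y p : A) (phi psi : {scalar A}).

(** Compatibility with the star, expressed on the basis: each e_(i,j) is self-adjoint and the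
    adjoint of E_(i,j) is E_(j,i). *)
Definition hermitian_functional phi :=
  (forall i j : Z, phi (e_ R i j) \is Num.real) /\
  (forall i j : Z, phi (E_ R j i) = (phi (E_ R i j))^*).

(** Polarization: positivity makes [phiE] real for every c. Taking c = 0 handles the diagonal, and c
    = 1 and c = 'i give the two hypotheses of [conj_of_realD]. *)
Lemma positive_hermitian phi :
  (forall x, 0 <= phi (kp_star x * x)) -> hermitian_functional phi.
Proof.
move=> phi_ge0.
have phiE i j (c : C) : phi (E_ R i i) + c * phi (E_ R i j) +
    c^* * phi (E_ R j i) + c^* * c * phi (E_ R j j) \is Num.real.
  (* A single nonzero row suffices: the adjoint of [M] times [M] is then the required combination of
     four matrix units. *)
  pose M : 'M[C]_((Zp_trunc n).+2) := delta_mx 0 i + c *: delta_mx 0 j.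
  have := phi_ge0 (0, M).
  move=> /ger0_real; congr (is_true (_ \is _)).
  have -> : kp_star ((0, M) : A) * (0, M) =
      E_ R i i + c *: E_ R i j + c^* *: E_ R j i + (c^* * c) *: E_ R j j.
    apply/pair_equal_spec; split.
      by apply/ffunP => ij; rewrite !ffunE mulr0 !scaler0 !addr0.
    have adjE : M^t* = delta_mx i 0 + c^* *: delta_mx j 0.
      apply/matrixP => k l; rewrite !mxE rmorphD rmorphM /= !conjC_nat.
      by rewrite [(l == 0) && _]andbC [(l == 0) && (k == j)]andbC.
    transitivity (M^t* *m M) => //.
    rewrite adjE /M mulmxDl !mulmxDr -!scalemxAl -!scalemxAr !mul_delta_mx scalerA.
    by rewrite !addrA.
  by rewrite !linearD !linearZ.
split=> i j.
  apply: ger0_real; have := phi_ge0 (e_ R i j); congr (0 <= phi _).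
  apply/pair_equal_spec; split; last by rewrite /= mulr0.
  apply/ffunP => kl; rewrite !ffunE; case: (kl == _); rewrite ?mulr0 //.
  by rewrite mulr1 conjC1.
have diag k : phi (E_ R k k) \is Num.real.
  by have := phiE k k 0; rewrite conjC0 !mul0r !addr0.
apply: conj_of_realD.
  have := phiE i j 1; rewrite conjC1 !mul1r => h.
  have -> : phi (E_ R i j) + phi (E_ R j i) =
    phi (E_ R i i) + phi (E_ R i j) + phi (E_ R j i) + phi (E_ R j j) -
    phi (E_ R i i) - phi (E_ R j j) by ring.
  by rewrite !realB.
have := phiE i j 'i; rewrite conjCi !mulNr -expr2 sqrCi mulN1r opprK => h.
set z := (X in X \is _); have -> : z =
    phi (E_ R i i) + 'i * phi (E_ R i j) - 'i * phi (E_ R j i) + phi (E_ R j j) -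
    phi (E_ R i i) - phi (E_ R j j) by rewrite /z; ring.
by rewrite !realB.
Qed.

Lemma haar_hermitian : hermitian_functional (haar R n).
Proof.
have nR : (2 * n%:R ^+ 2 : C)^-1 \is Num.real.
  by rewrite rpredV rpredM ?rpredX ?rpred_nat.
split=> i j; rewrite /= /haar_fun.
  rewrite rpredM // rpredD //.
    by apply: rpred_sum => k _; apply: rpred_sum => l _; rewrite ffunE realn.
  by rewrite rpredM ?rpred_nat //; apply: rpred_sum => k _; rewrite mxE rpred0.
rewrite (@CrealP _ _ _); last first.
  rewrite rpredM // rpredD //.
    by apply: rpred_sum => k _; apply: rpred_sum => l _; rewrite ffunE rpred0.
  by rewrite rpredM ?rpred_nat //; apply: rpred_sum => k _; rewrite mxE realn.
congr (_ * (_ + _ * _)); apply: eq_bigr => k _.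
by rewrite !mxE andbC.
Qed.

Lemma counit_hermitian : hermitian_functional (counit R n).
Proof.
by split=> i j; rewrite /= /counit_fun /= !ffunE ?realn ?conjC0.
Qed.

End Hermitian.

Section ConvHermitian.
Variables (R : realType) (m : nat).
Local Notation n := m.+2.
Local Notation C := R[i].
Local Notation Z := 'Z_n.
Local Notation A := (KP R n).
Implicit Types phi psi : {scalar A}.

(** Exchanging the two indices of the matrix units conjugates the phases in the coproduct, which
    therefore respects the star. *)
Lemma conv_hermitian phi psi :
  hermitian_functional phi -> hermitian_functional psi ->
  hermitian_functional (Defs.conv phi psi).
Proof.
move=> [phi_e phi_E] [psi_e psi_E]; split=> i j.
  rewrite conv_e rpredD //.
    by apply: rpred_sum => s _; apply: rpred_sum => t _; rewrite rpredM.
  rewrite rpredM ?rpredV ?rpred_nat //; apply/CrealP.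
  rewrite rmorph_sum exchange_big /=; apply: eq_bigr => k _.
  rewrite rmorph_sum; apply: eq_bigr => r _.
  rewrite !rmorphM /= conj_etaX -phi_E -psi_E; congr (etaX R _ * _); ring.
rewrite !conv_E rmorphD !rmorph_sum /=; congr (_ + _).
  apply: eq_bigr => s _; rewrite rmorph_sum; apply: eq_bigr => t _.
  rewrite !rmorphM /= conj_etaX -psi_E (CrealP (phi_e _ _)).
  by congr (etaX R _ * _); ring.
apply: eq_bigr => s _; rewrite rmorph_sum; apply: eq_bigr => t _.
rewrite !rmorphM /= conj_etaX -phi_E (CrealP (psi_e _ _)).
by congr (etaX R _ * _); ring.
Qed.

Lemma conv_pow_hermitian phi k :
  hermitian_functional phi -> hermitian_functional (conv_pow phi k).
Proof.
move=> phiH; elim: k => [|k IH]; first exact: counit_hermitian.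
exact: conv_hermitian.
Qed.

End ConvHermitian.

(** * Projections and the total variation distance *)

Section TotalVariation.
Variables (R : realType) (n : nat).
Local Notation C := R[i].
Local Notation Z := 'Z_n.
Local Notation A := (KP R n).
Implicit Types (x y p w : A) (phi psi : {scalar A}).

Lemma hermitian_real phi p :
  hermitian_functional phi -> kp_star p = p -> phi p \is Num.real.
Proof.
move=> [phi_e phi_E] pE.
have p1 : (kp_star p).1 = p.1 by rewrite pE.
have p2 : (kp_star p).2 = p.2 by rewrite pE.
rewrite scalar_coord rpredD //.
  apply: rpred_sum => i _; apply: rpred_sum => j _; rewrite rpredM //.
  by apply/CrealP; rewrite -[in RHS]p1 ffunE.
apply/CrealP; rewrite rmorph_sum exchange_big /=; apply: eq_bigr => i _.
rewrite rmorph_sum; apply: eq_bigr => j _.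
by rewrite rmorphM /= -phi_E -[in RHS]p2 !mxE.
Qed.

(** For a projection matrix, X_ii is the sum over k of |X_ik|^2. Thus X_ii^2 <= X_ii, so X_ii <= 1,
    and every |X_ij|^2 is at most X_ii. *)
Lemma norm_projection_coef p b : is_projection p -> `|kp_coef p b| <= 1.
Proof.
case: p => f X [pp pstar].
have ff : f * f = f by have := congr1 fst pp.
have XX : X *m X = X by have := congr1 snd pp.
have Xstar : X^t* = X by have := congr1 snd pstar.
case: b => [[[] i] j] /=; last first.
  have /eqP : f (i, j) * f (i, j) = f (i, j) by rewrite -[in RHS]ff ffunE.
  rewrite -subr_eq0 -[X in _ - X]mulr1 -mulrBr mulf_eq0 subr_eq0.
  by case/orP => /eqP ->; rewrite ?normr0 ?normr1.
have XE k l : (X l k)^* = X k l by rewrite -[in RHS]Xstar !mxE.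
have Xsum : X i i = \sum_k `|X i k| ^+ 2.
  rewrite -[in LHS]XX mxE; apply: eq_bigr => k _.
  by rewrite normCK XE.
have Xle k : `|X i k| ^+ 2 <= X i i.
  rewrite Xsum (bigD1 k) //= lerDl; apply: sumr_ge0 => l _.
  exact: exprn_ge0.
have X0 : 0 <= X i i by apply: le_trans (Xle i); exact: exprn_ge0.
have X1 : X i i <= 1.
  have := Xle i; rewrite ger0_norm // expr2 -subr_ge0 -[X in X - _]mulr1 -mulrBr.
  have [->|Xn0] := eqVneq (X i i) 0; first by rewrite ler01.
  by rewrite pmulr_rge0 ?subr_ge0 // lt_def Xn0.
by rewrite -(@expr_le1 _ 2) //; exact: le_trans (Xle j) X1.
Qed.

Lemma qtv_upper phi psi p :
  is_projection p -> `|phi p - psi p| <= (qtv phi psi)%:C%C.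
Proof.
move=> pP; have -> : `|phi p - psi p| = (Normc.normc (phi p - psi p))%:C%C by [].
rewrite lecR; apply: ub_le_sup; last by exists p.
(* The supremum bounds its set only once the set is known to be bounded; the coefficients of
   projections have modulus at most 1. *)
have ub : exists M : C, forall q, is_projection q -> `|phi q - psi q| <= M.
  exists (\sum_b `|phi (kp_basis R b) - psi (kp_basis R b)|) => q qP.
  have decomp (f : {scalar A}) : f q = \sum_b kp_coef q b * f (kp_basis R b).
    rewrite {1}[q]kp_decomp linear_sum; apply: eq_bigr => b _.
    by rewrite linearZ.
  rewrite !decomp -sumrB.
  apply: le_trans (ler_norm_sum _ _ _) _; apply: ler_sum => b _.
  rewrite -mulrBr normrM; apply: ler_piMl => //.
  exact: norm_projection_coef.
case: ub => M HM; exists (complex.Re M) => _ [q qP <-].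
by have := HM q qP; rewrite lecE => /andP[].
Qed.

End TotalVariation.

(** * Finite coordinates and unitary diagonalization *)

Lemma scalar_ffun (K : nzRingType) (I : finType) (f : {ffun I -> K^o} -> K) :
  scalar f ->
  forall d : {ffun I -> K}, f d = \sum_i d i * f [ffun j => (j == i)%:R].
Proof.
move=> /scalar_morphisms[_ fZ fsum] d.
have {1}-> : d = \sum_i d i *: [ffun j => (j == i)%:R : K^o] :> {ffun I -> K^o}.
  apply/ffunP => j; rewrite sum_ffunE (bigD1 j) //= !ffunE eqxx.
  rewrite big1 => [|i /negPf ij]; first by rewrite addr0 -[LHS]mulr1.
  by rewrite !ffunE eq_sym ij scaler0.
by rewrite fsum; apply: eq_bigr => i _; rewrite fZ.
Qed.

Section UnitaryConjugate.
Variables (C : numClosedFieldType) (k : nat) (P : 'M[C]_k).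
Implicit Types d e : 'rV[C]_k.

Definition udiag_mx d : 'M[C]_k := P^t* *m diag_mx d *m P.

Lemma udiag_mx_is_linear : linear udiag_mx.
Proof.
move=> b d e; rewrite /udiag_mx scalemxAl scalemxAr -mulmxDl -mulmxDr.
by rewrite linearP.
Qed.

Lemma udiag_mxM d e : P \is unitarymx ->
  udiag_mx d *m udiag_mx e = udiag_mx (\row_i (d 0 i * e 0 i)).
Proof.
move=> PU; rewrite /udiag_mx !mulmxA mulmxtVK // -!mulmxA; congr (_ *m _).
by rewrite !mulmxA mulmx_diag.
Qed.

Lemma udiag_mx_star d : (udiag_mx d)^t* = udiag_mx (map_mx Num.conj d).
Proof.
by rewrite /udiag_mx !trmx_mul !map_mxM trmxCK tr_diag_mx map_diag_mx mulmxA.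
Qed.

Lemma udiag_mx_inj : P \is unitarymx -> injective udiag_mx.
Proof.
move=> PU d e /(congr1 (fun M => P *m M *m P^t*)).
rewrite /udiag_mx !mulmxA (unitarymxP PU) !mul1mx !mulmxtVK // => /matrixP de.
by apply/rowP => i; have := de i i; rewrite !mxE eqxx.
Qed.

End UnitaryConjugate.

(** After spectral diagonalization the partial isometry equation reads |d_i|^2 d_i = d_i, so each
    eigenvalue is 0 or has modulus 1. *)
Lemma normal_partial_isometry_diag (C : numClosedFieldType) k (M : 'M[C]_k) :
  M \is normalmx -> M *m M^t* *m M = M ->
  exists2 P : 'M[C]_k, P \is unitarymx &
    exists2 d : 'rV_k, forall i, `|d 0 i| <= 1 & M = udiag_mx P d.
Proof.
set P := spectralmx M => /orthomx_spectralP ME MK.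
have PU : P \is unitarymx by exact: spectral_unitarymx.
exists P => //; exists (spectral_diag M) => [i|]; last first.
  by rewrite /udiag_mx -invmx_unitary.
set d := spectral_diag M in ME *.
rewrite invmx_unitary // -/P -/(udiag_mx P d) in ME.
move: MK; rewrite ME udiag_mx_star !(udiag_mxM _ _ PU).
move=> /(udiag_mx_inj PU)/rowP/(_ i).
rewrite !mxE -normCK => /eqP.
rewrite -subr_eq0 -[X in _ - X]mul1r -mulrBl mulf_eq0.
case/orP => [|/eqP ->]; last by rewrite normr0.
by rewrite subr_eq0 sqrp_eq1 // => /eqP ->.
Qed.

(** * Reduction to a commutative subalgebra *)

Section NormalPartialIsometries.
Variables (R : realType) (n : nat).
Local Notation C := R[i].
Local Notation Z := 'Z_n.
Local Notation A := (KP R n).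
Local Notation N := (Zp_trunc n).+2.
Implicit Types (phi psi : {scalar A}).

Section Diagonal.
Variable P : 'M[C]_N.
Hypothesis P_unitary : P \is unitarymx.
Local Notation I := ((Z * Z) + Z)%type.
Implicit Types c d : {ffun I -> C}.

(** The functions on a finite set, embedded as a commutative star-subalgebra: the whole commutative
    block together with the matrices diagonal in the basis given by [P]. *)
Definition kp_diag c : A :=
  ([ffun ij => c (inl ij)], udiag_mx P (\row_k c (inr k))).

Lemma kp_diag_is_linear : linear kp_diag.
Proof.
move=> b c d; apply/pair_equal_spec; split => /=.
  by apply/ffunP => ij; rewrite !ffunE.
rewrite -udiag_mx_is_linear; congr udiag_mx.
by apply/rowP => k; rewrite !mxE !ffunE.
Qed.

Lemma kp_diagM c d : kp_diag c * kp_diag d = kp_diag [ffun i => c i * d i].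
Proof.
apply/pair_equal_spec; split => /=; first by apply/ffunP => ij; rewrite !ffunE.
rewrite -[LHS]/(_ *m _) (udiag_mxM _ _ P_unitary); congr udiag_mx.
by apply/rowP => k; rewrite !mxE ffunE.
Qed.

Lemma kp_diag_star c : kp_star (kp_diag c) = kp_diag [ffun i => (c i)^*].
Proof.
apply/pair_equal_spec; split => /=; first by apply/ffunP => ij; rewrite !ffunE.
rewrite [LHS]udiag_mx_star; congr udiag_mx.
by apply/rowP => k; rewrite !mxE ffunE.
Qed.

Lemma kp_diag_projection (S : pred I) :
  is_projection (kp_diag [ffun i => (S i)%:R]).
Proof.
split; first rewrite kp_diagM; last rewrite kp_diag_star; congr kp_diag.
  by apply/ffunP => i; rewrite !ffunE -natrM mulnb andbb.
by apply/ffunP => i; rewrite !ffunE conjC_nat.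
Qed.

(** On this subalgebra the difference is a finite real signed measure with masses [r i]. Its total
    mass in absolute value exceeds no more than twice the largest value on a subset. *)
Lemma norm_kp_diag_le phi psi c :
  hermitian_functional phi -> hermitian_functional psi ->
  (forall i, `|c i| <= 1) ->
  `|phi (kp_diag c) - psi (kp_diag c)| <= 2 * (qtv phi psi)%:C%C.
Proof.
move=> phiH psiH c1; pose F d : C := phi (kp_diag d) - psi (kp_diag d).
have FL : scalar F.
  have lin (f : {scalar A}) b d e :
      f (kp_diag (b *: d + e)) = b * f (kp_diag d) + f (kp_diag e).
    by rewrite kp_diag_is_linear linearD linearZ.
  move=> b d e; rewrite /F.
  transitivity (b * phi (kp_diag d) + phi (kp_diag e) -
    (b * psi (kp_diag d) + psi (kp_diag e))); first by congr (_ - _); apply: lin.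
  by rewrite mulrBr opprD addrACA.
pose r i := F [ffun j => (j == i)%:R].
have FE d : F d = \sum_i d i * r i := scalar_ffun FL d.
have r_real i : r i \is Num.real.
  have [_ starE] := kp_diag_projection (pred1 i).
  by rewrite rpredB ?hermitian_real.
(* The positive set of a Hahn decomposition: the sum of the |r_i| is the measure of [S] minus that
   of its complement, each bounded by the distance. *)
pose S := [pred i | 0 <= r i].
have FS_le (T : pred I) : `|F [ffun i => (T i)%:R]| <= (qtv phi psi)%:C%C.
  exact/qtv_upper/kp_diag_projection.
rewrite -/(F c) FE; apply: le_trans (ler_norm_sum _ _ _) _.
have -> : 2 * (qtv phi psi)%:C%C = (qtv phi psi)%:C%C + (qtv phi psi)%:C%C by ring.
apply: le_trans (lerD (FS_le S) (FS_le (predC S))).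
apply: le_trans (ler_normB _ _); rewrite !FE -sumrB.
apply: le_trans (real_ler_norm _); last first.
  by apply: rpred_sum => i _; rewrite !ffunE rpredB // rpredM ?rpred_nat.
apply: ler_sum => i _; rewrite !ffunE normrM.
apply: le_trans (ler_piMl (normr_ge0 _) (c1 i)) _.
rewrite /=; have [r_ge0|] := boolP (0 <= r i).
  by rewrite mul1r mul0r subr0 ger0_norm.
rewrite -real_ltNge // => r_lt0.
by rewrite mul0r mul1r sub0r ltr0_norm.
Qed.

End Diagonal.

Lemma norm_le_2qtv phi psi (w : A) :
  hermitian_functional phi -> hermitian_functional psi ->
  (forall ij, `|w.1 ij| <= 1) -> w.2 \is normalmx ->
  w.2 *m w.2^t* *m w.2 = w.2 ->
  Normc.normc (phi w - psi w) <= 2 * qtv phi psi.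
Proof.
move=> phiH psiH w1 w2N /(normal_partial_isometry_diag w2N)[P PU [d d1 w2E]].
pose c : {ffun (Z * Z) + Z -> C} :=
  [ffun i => match i with inl ij => w.1 ij | inr k => d 0 k end].
have wE : w = kp_diag P c.
  rewrite [LHS]surjective_pairing; apply/pair_equal_spec; split.
    by apply/ffunP => ij; rewrite !ffunE.
  rewrite /= w2E; congr udiag_mx.
  by apply/rowP => k; rewrite !mxE ffunE.
have c1 i : `|c i| <= 1 by rewrite ffunE; case: i.
have := norm_kp_diag_le PU phiH psiH c1; rewrite -wE.
have -> : 2 * (qtv phi psi)%:C%C = (2 * qtv phi psi)%:C%C :> C.
  by rewrite rmorphM /= rmorph_nat.
by rewrite lecR.
Qed.

End NormalPartialIsometries.

(** * The test elements are normal partial isometries *)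

Lemma unitarymxZ (C : numClosedFieldType) k (c : C) (M : 'M[C]_k) :
  c * c^* = 1 -> M \is unitarymx -> c *: M \is unitarymx.
Proof.
move=> cc /unitarymxP MM; apply/unitarymxP.
have -> : (c *: M)^t* = c^* *: M^t*.
  by apply/matrixP => i j; rewrite !mxE rmorphM.
by rewrite -scalemxAl -scalemxAr scalerA MM cc scale1r.
Qed.

Lemma unitarymx_normal_partial_isometry (C : numClosedFieldType) k
    (M : 'M[C]_k) : M \is unitarymx ->
  M \is normalmx /\ M *m M^t* *m M = M.
Proof.
move=> /unitarymxP MM; split; last by rewrite MM mul1mx.
by apply/normalmxP; rewrite MM (mulmx1C MM).
Qed.

Section AdjointCoefficients.
Variables (R : realType) (m : nat).
Local Notation n := m.+2.
Local Notation C := R[i].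
Local Notation Z := 'Z_n.
Local Notation A := (KP R n).
Local Notation "'η'" := (etaX R (n := n)).

Lemma kph_unitarymx (u v : Z) : (kph R u v).2 \is unitarymx.
Proof.
apply/unitarymxP/matrixP => i k; rewrite mxE (bigD1 (i + u)) //= big1 => [|j ji].
  rewrite addr0 !mxE eqxx mulr1 (inj_eq (addIr u)) rmorphM /= conjC_nat.
  by have [->|] := eqVneq i k; rewrite ?mulr0 // mulr1 -normCK norm_etaX expr1n.
by rewrite !mxE (negPf ji) mulr0 mul0r.
Qed.

Lemma irr_adj_normal_partial_isometry (al : Irr n) (w := irr_adj R al) :
  (forall ij, `|w.1 ij| <= 1) /\ (w.2 \is normalmx /\ w.2 *m w.2^t* *m w.2 = w.2).
Proof.
have kp1P (l v : Z) s (y := kp1_adj R l v s) : (forall ij, `|y.1 ij| <= 1) /\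
    (y.2 \is normalmx /\ y.2 *m y.2^t* *m y.2 = y.2).
  split=> [ij|].
    by rewrite !ffunE /= scaler0 addr0 norm_etaX.
  apply: unitarymx_normal_partial_isometry.
  rewrite /y /kp1_adj; set c := bsign C s * _.
  have c1 : c * c^* = 1.
    rewrite -normCK normrM norm_etaX mulr1.
    by case: (s); rewrite /= ?normrN normr1 expr1n.
  by rewrite [_.2]add0r; apply: unitarymxZ => //; exact: kph_unitarymx.
case: al @w => [l s|u v|ev l s] w; [exact: kp1P| |exact: kp1P].
(* In dimension two the matrix part is zero, so it is a partial isometry but not unitary. *)
split=> [ij|]; first by rewrite ffunE norm_etaX.
split; last by rewrite mulmx0.
by apply/normalmxP; rewrite mul0mx mulmx0.
Qed.

End AdjointCoefficients.

(** * The lower bound *)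

Theorem lemma3p3 (R : realType) (n : nat) (hn : (2 <= n)%N)
    (a : Irr n -> R[i])
    (ha : is_state (fourier (\sum_(al : Irr n) a al *: irr_char R al)))
    (alpha : Irr n) (halpha : alpha != Rho 0 true) (k : nat) :
  2^-1 * Normc.normc (a alpha / (irr_dim alpha)%:R) ^+ k <=
  qtv (conv_pow (fourier (\sum_(al : Irr n) a al *: irr_char R al)) k)
      (haar R n).
Proof.
(* Writing n as m + 2 makes the modulus of ['Z_n] compute to n. *)
case: n hn a ha alpha halpha => [|[|m]] // _ a [a_ge0 _] alpha alpha0.
have [w1 [w2 w3]] := irr_adj_normal_partial_isometry R alpha.
have := norm_le_2qtv (conv_pow_hermitian k (positive_hermitian a_ge0))
  (haar_hermitian R m.+2) w1 w2 w3.
rewrite conv_pow_irr_adj haar_irr_adj // subr0.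
(* Once the norm commutes with powers, only the factor 2 has to change sides. *)
suff -> z : Normc.normc (z ^+ k) = Normc.normc z ^+ k :> R.
  by rewrite ler_pdivrMl ?ltr0n.
elim: k => [|k IH]; first exact: Normc.normc1.
by rewrite !exprS Normc.normcM IH.
Qed.
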